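(* Let $f$ be a real-valued function on $\mathbb{R}^n$, let $\{x_k\}_{k\ge 0}\subset\mathbb{R}^n$ be an infinite sequence of iterates, let $\{f_k\}_{k\ge 0}$ with $f_k=f(x_k)$ be a monotonically decreasing (i.e. $f_{k+1}\le f_k$ for all $k\ge 0$) sequence that is bounded below, and let $\{\omega_k\}_{k\ge 0}$ with $\omega_k=\omega(x_k)$, for some function $\omega:\mathbb{R}^n\to[0,+\infty)$, be a non-negative sequence of optimality measures. Let $\mathcal{S}=\{k\ge 0 \mid x_{k+1}\neq x_k\}$ be the set of successful iterations and, for $k\ge 0$, let $\mathcal{S}_k=\mathcal{S}\cap\{0,\ldots,k\}$. Suppose that $$\mathcal{S}\cap\{k\ge 0\mid \omega_k=0\}=\emptyset$$ and that $$f_k-f_{k+1}\ \ge\ \kappa_d\,\omega_k^{\beta}\quad\text{for all } k\in\mathcal{S},$$ where $\kappa_d\in(0,1]$ and $\beta>0$ are constants. Suppose also that there exist constants $\kappa_a\ge 1$ and $\kappa_b,\kappa_c\ge 0$ such that, for all $k\ge 0$, $$k\ \le\ \kappa_a|\mathcal{S}_k|+\kappa_b|\log(\omega_k)|+\kappa_c\quad\text{whenever }\omega_k>0.$$ Then $$\lim_{k\to\infty}\omega_k=0.$$ Moreover, with $k(\epsilon)=\min\{k\ge 0\mid \omega_k\le\epsilon\}$ for $\epsilon>0$, either $k(\epsilon)$ is constant for all $\epsilon>0$ sufficiently small, or, for all $\epsilon>0$ sufficiently small, $$k(\epsilon)\ \le\ \kappa_a\max\left[1,\frac{2\big(f_{\ell(k(\epsilon)-1)}-f_{k(\epsilon)}\big)}{\kappa_d\,\epsilon^{\beta}}\right]+\kappa_b|\log(\epsilon)|+\kappa_a+\kappa_c,$$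 where $\ell(k)$ is the largest index (non-negative integer) smaller than or equal to the median of the indexes in $\mathcal{S}_k$, and $$\lim_{\epsilon\to 0}\big(f_{\ell(k(\epsilon)-1)}-f_{k(\epsilon)-1}\big)=0.$$ In all cases, $$k(\epsilon)=o\big(\epsilon^{-\beta}\big)\quad\text{as }\epsilon\to 0.$$
   Context: The limit $\epsilon\to 0$ is taken over $\epsilon>0$. For functions $a(\epsilon)$ and $b(\epsilon)>0$ of a parameter $\epsilon$ tending to zero, $a(\epsilon)=o(b(\epsilon))$ means $\limsup_{\epsilon\to 0}\big(a(\epsilon)/b(\epsilon)\big)\le 0$. For a set $\mathcal{S}$, $|\mathcal{S}|$ denotes its cardinality. The median of a finite set of integers with an even number of elements is the average of its two middle elements. The sequences are infinite and are thought of as generated by an optimization algorithm applied to minimize $f$ starting from $x_0$; all results are asymptotic, concerning the behaviour of $k(\epsilon)$ as the accuracy $\epsilon$ tends to zero. The quantity $\ell(k)$ is considered only for $k$ such that $\mathcal{S}_k$ is non-empty. *)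

(* Defs.v *)
From HB Require Import structures.
From mathcomp Require Export all_boot all_order all_algebra finmap.
From mathcomp Require Export all_classical all_reals all_analysis.
Export Order.TTheory GRing.Theory Num.Theory.
Export numFieldNormedType.Exports.

Set Implicit Arguments.
Unset Strict Implicit.
Unset Printing Implicit Defensive.

Local Open Scope classical_set_scope.
Local Open Scope ring_scope.

Definition successful (T : Type) (x : nat -> T) : set nat :=
  [set k | x k.+1 <> x k].

(* `I_k.+1 is the set of naturals {0, ..., k} *)
Definition successful_upto (T : Type) (x : nat -> T) (k : nat) : set nat :=
  successful x `&` `I_k.+1.

(* Every successful_upto x k is finite, so fset_set is faithful on it. *)
Definition nsuccessful (T : Type) (x : nat -> T) (k : nat) : nat :=
  #|` fset_set (successful_upto x k)|.

(* Meaningful for nonempty A; median fset0 = 0. *)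
Definition median (A : {fset nat}) : rat :=
  let s := sort leq A in
  let m := size s in
  if odd m then (nth 0%N s m./2)%:R
  else ((nth 0%N s m./2.-1)%:R + (nth 0%N s m./2)%:R) / 2.

(* Num.truncn q is the largest natural number below q >= 0. *)
Definition ell (T : Type) (x : nat -> T) (k : nat) : nat :=
  Num.truncn (median (fset_set (successful_upto x k))).

(* min {k | w k <= eps}, with value 0 if this set is empty *)
Definition first_below (R : realType) (w : nat -> R) (eps : R) : nat :=
  if pselect (exists k, w k <= eps) is left h then ex_minn h else 0%N.

(* One-sided: only an upper bound on a / b is required. *)
Definition is_little_o (R : realType) (a b : R -> R) : Prop :=
  (limf_esup (fun eps => (a eps / b eps)%:E) (0 : R)^'+ <= 0)%E.

(* Main.v *)
Require Import Defs.
From mathcomp Require Import zify ring lra.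

(** A successful iteration with omega > eps decreases f by at least
    c := kappa_d eps^beta, and f is bounded below, so decreases tend to 0 and
    omega tends to 0 along the successful iterations.  An unsuccessful iteration
    does not move, hence it has the same omega as the next successful one; if
    there is no next one, omega stays constant while the iteration bound caps
    the index, which is absurd unless omega = 0.  So omega tends to 0
    ([omega_cvg0]).

    If omega vanishes somewhere, k(eps) is eventually the first index where it
    does ([first_below_cst]).  Otherwise there are infinitely many successes and
    k(eps) tends to infinity.  Put k = k(eps).  All the iterations before k have
    omega > eps, and at least half of the successes up to k - 1 have an index at
    least ell(k - 1), since ell is the integer part of the median.  Counting the
    decreases of these late successes alone gives
      |S_(k-1)| c / 2 <= f(x_ell(k-1)) - f(x_k)
    ([nsuccessful_le_ell]), and the iteration bound at k - 1 turns this into the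
    bound on k(eps) ([first_below_bound]).

    The gain over a bound by the total decrease of f is that ell(k - 1) also
    tends to infinity: the p-th natural number of an increasing sequence is at
    least p, so the median of m indices is at least about m / 2 ([ell_cvgny]).
    As f(x_k) converges, the differences of f above tend to 0; multiplying the
    bound by eps^beta, and using that eps^beta |ln eps| tends to 0, gives
    k(eps) = o(eps^-beta). *)

Set Implicit Arguments.
Unset Strict Implicit.
Unset Printing Implicit Defensive.

Local Open Scope classical_set_scope.
Local Open Scope ring_scope.

(** * First index below a threshold *)

Lemma near_at_right_lt_prefix (R : realType) (w : nat -> R) (N : nat) :
  (forall j, (j < N)%N -> 0 < w j) ->
  \forall eps \near (0 : R)^'+, forall j, (j < N)%N -> eps < w j.
Proof.
elim: N => [_|N IH w_gt0]; first by near=> eps.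
near=> eps => j; rewrite ltnS leq_eqVlt => /orP[/eqP ->|ltjN].
  by near: eps; apply: nbhs_right_lt; exact: w_gt0.
move: j ltjN; near: eps; apply: IH => j ltjN.
by apply: w_gt0; rewrite ltnS ltnW.
Unshelve. all: by end_near. Qed.

Lemma first_belowP (R : realType) (w : nat -> R) (eps : R) :
  (exists k, w k <= eps) ->
  w (first_below w eps) <= eps /\
  forall j, (j < first_below w eps)%N -> eps < w j.
Proof.
move=> h; rewrite /first_below; case: pselect => // h'.
case: ex_minnP => m wm m_min; split=> // j ltjm.
by rewrite ltNge; apply/negP => /m_min; rewrite leqNgt ltjm.
Qed.

(** Take for N the first zero of w: once eps is below the finitely many positive
    values w 0, ..., w (N - 1), no earlier index qualifies. *)
Lemma first_below_cst (R : realType) (w : nat -> R) :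
  (forall k, 0 <= w k) -> (exists k, w k = 0) ->
  exists N, \forall eps \near (0 : R)^'+, first_below w eps = N.
Proof.
move=> w_ge0 [k wk0].
have h : exists k, w k == 0 by exists k; apply/eqP.
case: (ex_minnP h) => N /eqP wN0 N_min; exists N.
have w_gt0 j : (j < N)%N -> 0 < w j.
  move=> ltjN; rewrite lt0r w_ge0 andbT; apply/negP => /N_min.
  by rewrite leqNgt ltjN.
near=> eps.
have eps0 : 0 < eps by [].
have [] := @first_belowP _ w eps; first by exists N; rewrite wN0 ltW.
move=> w_le w_lt; apply/eqP; rewrite eqn_leq; apply/andP; split.
  by rewrite leqNgt; apply/negP => /w_lt; rewrite wN0 ltNge ltW.
rewrite leqNgt; apply/negP => lt_N.
have : eps < w (first_below w eps).
  by move: (first_below w eps) lt_N; near: eps; exact: near_at_right_lt_prefix.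
by rewrite ltNge w_le.
Unshelve. all: by end_near. Qed.

(** Any finite prefix of w stays above a small enough eps, so the first index
    below eps leaves every bounded range. *)
Lemma first_below_cvgny (R : realType) (w : nat -> R) :
  (forall k, 0 < w k) -> w k @[k --> \oo] --> 0 ->
  first_below w eps @[eps --> (0 : R)^'+] --> \oo.
Proof.
move=> w_gt0 w_cvg; apply/cvgnyPge => A; near=> eps.
have eps0 : 0 < eps by [].
have [] := @first_belowP _ w eps.
  have [N _ wN] := @cvgr_le _ _ _ _ _ _ w_cvg eps eps0.
  by exists N; apply: (wN N) => /=.
move=> w_le _; rewrite leqNgt; apply/negP => lt_A.
have : eps < w (first_below w eps).
  by move: (first_below w eps) lt_A; near: eps; exact: near_at_right_lt_prefix.
by rewrite ltNge w_le.
Unshelve. all: by end_near. Qed.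

(** * Asymptotics at 0 *)

(** Bounding [a / b] above by a vanishing function suffices because
    [is_little_o] is one-sided. *)
Lemma is_little_o_le (R : realType) (a b g : R -> R) :
  (\forall eps \near (0 : R)^'+, a eps / b eps <= g eps) ->
  g eps @[eps --> (0 : R)^'+] --> 0 -> is_little_o a b.
Proof.
move=> ab_le g_cvg; rewrite /is_little_o limf_esupE.
apply/lee_addgt0Pr => e e0; rewrite add0e.
apply: ge_ereal_inf.
exists (ereal_sup [set (a eps / b eps)%:E | eps in [set eps | a eps / b eps <= e]]).
  exists [set eps | a eps / b eps <= e] => //.
  change (\forall eps \near (0 : R)^'+, a eps / b eps <= e).
  near=> eps.
  apply: (@le_trans _ _ (g eps)); first by near: eps.
  by near: eps; exact: (@cvgr_le _ _ _ _ _ _ g_cvg e e0).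
by apply/ereal_supP => _ [eps /= ? <-]; rewrite lee_fin.
Unshelve. all: by end_near. Qed.

(** Applying [ln y < y] to [y = eps `^ (- b / 2)] bounds [`|ln eps|] by
    [(2 / b) * eps `^ (- b / 2)], which leaves half of the power to spare. *)
Lemma powR_norm_ln_cvg0 (R : realType) (b : R) : 0 < b ->
  eps `^ b * `|ln eps| @[eps --> (0 : R)^'+] --> 0.
Proof.
move=> b0.
have b20 : 0 < b / 2 by rewrite divr_gt0.
apply: (@squeeze_cvgr _ _ _ _ (fun=> 0) (fun eps => (2 / b) * eps `^ (b / 2))).
- near=> eps.
  have eps0 : 0 < eps by [].
  have eps1 : eps < 1 by near: eps; exact: nbhs_right_lt.
  rewrite mulr_ge0 ?powR_ge0//=.
  rewrite ler0_norm ?ln_le0 ?ltW//.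
  have p0 : 0 < eps `^ (b / 2) by rewrite powR_gt0.
  have -> : b = b / 2 + b / 2 by lra.
  rewrite powRD ?(gt_eqF eps0) ?implybT// -!splitr.
  have := @ln_sublinear R (eps `^ (b / 2))^-1; rewrite invr_gt0 => /(_ p0).
  rewrite lnV ?posrE// ln_powR => h.
  have {}h : eps `^ (b / 2) * - (b / 2 * ln eps) < 1.
    by rewrite -ltr_pdivlMl// mulr1.
  rewrite -mulrA [ltRHS]mulrC ltr_pM2l// ltr_pdivlMr//; lra.
- exact: cvg_cst.
- rewrite -[X in _ --> X](mulr0 (2 / b)).
  by apply: cvgM; [exact: cvg_cst | exact: powR_cvg0].
Unshelve. all: by end_near. Qed.

Lemma norm_ln_le (R : realType) (a b : R) :
  0 < a -> a <= b -> b <= 1 -> `|ln b| <= `|ln a|.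
Proof.
move=> a0 leab leb1; have b0 := lt_le_trans a0 leab.
rewrite !ler0_norm ?ln_le0 ?(le_trans leab)//.
by rewrite lerN2 ler_ln ?posrE.
Qed.

(** * Medians and counting of successful iterations *)

Lemma ltn_sorted_sort_fset (A : {fset nat}) : sorted ltn (sort leq A).
Proof.
rewrite ltn_sorted_uniq_leq sort_uniq fset_uniq.
exact/sort_sorted/leq_total.
Qed.

Lemma ltn_sorted_nth_ge (s : seq nat) (i : nat) :
  sorted ltn s -> (i < size s)%N -> (i <= nth 0%N s i)%N.
Proof.
move=> s_sorted; elim: i => // i IH lt_i.
apply: leq_ltn_trans (IH (ltnW lt_i)) _.
by apply: (sorted_ltn_nth ltn_trans 0%N s_sorted); rewrite ?inE ?(ltnW lt_i).
Qed.

(** With an even number of elements the median averages the two middle ones and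
    is thus at most the upper one: in both parities the upper half of A, from
    rank #|A|/2 on, lies above the integer part of the median. *)
Lemma truncn_median_le (A : {fset nat}) :
  (Num.truncn (median A) <= nth 0%N (sort leq A) (#|` A|)./2)%N.
Proof.
rewrite /median size_sort -/(#|` A|); set s := sort leq A.
set m := #|` A|; case: ifPn => [_|even_m]; first by rewrite natrK.
rewrite -[leqRHS](@natrK rat); apply: le_truncn.
have : (nth 0%N s m./2.-1 <= nth 0%N s m./2)%N.
  have [m0|m_gt0] := posnP m; first by rewrite m0.
  apply: (sorted_leq_nth leq_trans leqnn 0%N).
  - exact/sort_sorted/leq_total.
  - by rewrite inE size_sort -/m; lia.
  - by rewrite inE size_sort -/m; lia.
  - by lia.
rewrite -(ler_nat rat); lra.
Qed.

(** The element of rank i in a set of naturals is at least i, so a median can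
    only be small when the set is small.  The predecessor is the rank of the lower
    of the two middle elements in the even case. *)
Lemma truncn_median_ge (A : {fset nat}) :
  ((#|` A|)./2.-1 <= Num.truncn (median A))%N.
Proof.
rewrite /median size_sort -/(#|` A|); set s := sort leq A.
set m := #|` A|.
have le_nth i : (i < m)%N -> (i <= nth 0%N s i)%N.
  move=> lt_i; apply: ltn_sorted_nth_ge; first exact: ltn_sorted_sort_fset.
  by rewrite size_sort.
case: ifPn => [odd_m|even_m].
  by rewrite natrK; apply: leq_trans (leq_pred _) (le_nth _ _); lia.
have [m0|m_gt0] := posnP m; first by rewrite m0.
rewrite truncn_ge_nat; last by rewrite divr_ge0 ?addr_ge0.
have := le_nth m./2 ltac:(lia); have := le_nth m./2.-1 ltac:(lia).
have : (m./2.-1 <= m./2)%N by lia.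
rewrite -!(ler_nat rat); lra.
Qed.

(** The intervals [j, j + 1] for j in s are disjoint and lie in [a, b], and u
    loses at least c on each of them. *)
Lemma sorted_decrease_le (R : realType) (u : nat -> R) (c : R) (b : nat)
    (s : seq nat) (a : nat) :
  (forall k, u k.+1 <= u k) -> (a <= b)%N -> sorted ltn s ->
  (forall j, j \in s -> (a <= j < b)%N /\ c <= u j - u j.+1) ->
  (size s)%:R * c <= u a - u b.
Proof.
move=> u_decr.
have u_mono : {homo u : i j / (i <= j)%N >-> j <= i}.
  exact/nonincreasing_seqP.
elim: s a => [|j s IH] a leab /=.
  by rewrite mul0r subr_ge0 => *; exact: u_mono.
move=> s_path s_in.
have [/andP[leaj ltjb] cj] := s_in j (mem_head _ _).
have := IH j.+1 ltjb (path_sorted s_path).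
have j_min := order_path_min ltn_trans s_path.
move=> /(_ _)/wrap[i si|le_s].
  have [] := s_in i; first by rewrite inE si orbT.
  by move=> /andP[_ ->] ->; have /allP/(_ _ si)/= -> := j_min.
have := u_mono _ _ leaj.
rewrite -[(size s).+1]addn1 natrD mulrDl mul1r; lra.
Qed.

Lemma finite_successful_upto (T : Type) (x : nat -> T) (k : nat) :
  finite_set (successful_upto x k).
Proof. exact/finite_setIr/finite_II. Qed.

Lemma mem_successful_upto (T : Type) (x : nat -> T) (k j : nat) :
  j \in fset_set (successful_upto x k) -> successful x j /\ (j <= k)%N.
Proof.
rewrite in_fset_set ?inE; last exact: finite_successful_upto.
by rewrite /successful_upto /= ltnS.
Qed.

(** Only the successes from rank m / 2 on are counted: they are at least
    half of the m successes up to k, hence the factor 2, and all have an index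
    at least [ell x k]. *)
Lemma nsuccessful_le_ell (T : Type) (x : nat -> T) (R : realType)
    (u : nat -> R) (c : R) (k : nat) :
  (forall j, u j.+1 <= u j) -> 0 <= c ->
  (forall j, successful x j -> (j <= k)%N -> c <= u j - u j.+1) ->
  (nsuccessful x k)%:R * c <= 2 * (u (ell x k) - u k.+1).
Proof.
move=> u_decr c0 u_dec.
have u_mono : {homo u : i j / (i <= j)%N >-> j <= i}.
  exact/nonincreasing_seqP.
set A := fset_set (successful_upto x k); set s := sort leq A.
have size_s : size s = nsuccessful x k by rewrite size_sort.
set m := nsuccessful x k in size_s *.
have mem_s j : j \in s -> successful x j /\ (j <= k)%N.
  by rewrite mem_sort; exact: mem_successful_upto.
have ell_le : (ell x k <= nth 0%N s m./2)%N by exact: truncn_median_le.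
(* Without successes, ell is 0: the sequence is empty and nth returns 0. *)
have [m0|m_gt0] := posnP m.
  rewrite m0 mul0r mulr_ge0// subr_ge0; apply: u_mono.
  apply: leq_trans ell_le _; rewrite nth_default//.
  by rewrite size_s m0.
have s_sorted : sorted ltn s by exact: ltn_sorted_sort_fset.
have ltm2 : (m./2 < size s)%N by rewrite size_s; lia.
have nth_k : (nth 0%N s m./2 <= k)%N by apply: (mem_s _ _).2; exact: mem_nth.
have : (size (drop m./2 s))%:R * c <= u (ell x k) - u k.+1.
  apply: sorted_decrease_le => //.
  - by apply: leq_trans ell_le (leq_trans nth_k _).
  - exact: drop_sorted.
  - move=> j js; have [sj lejk] := mem_s j (mem_drop js).
    split; last exact: u_dec.
    rewrite ltnS lejk andbT; apply: leq_trans ell_le _.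
    have /(nthP 0%N)[i lti <-] := js; rewrite nth_drop.
    move: lti; rewrite size_drop => lti.
    apply: (sorted_leq_nth leq_trans leqnn 0%N).
    + exact/sort_sorted/leq_total.
    + by rewrite inE.
    + by rewrite inE -ltn_subRL.
    + by lia.
rewrite size_drop size_s => le_half.
have : m%:R * c <= 2 * ((m - m./2)%:R * c).
  by rewrite mulrA ler_wpM2r// -natrM ler_nat; lia.
move=> /le_trans; apply; rewrite ler_pM2l//.
Qed.

Lemma leq_nsuccessful (T : Type) (x : nat -> T) (k k' : nat) :
  (k <= k')%N -> (nsuccessful x k <= nsuccessful x k')%N.
Proof.
move=> le_k; apply: fsubset_leq_card.
rewrite -fset_set_sub; try exact: finite_successful_upto.
by move=> j [sj /= ltj]; split=> //=; exact: leq_trans ltj _.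
Qed.

Lemma ltn_nsuccessful (T : Type) (x : nat -> T) (k k' : nat) :
  (k < k')%N -> successful x k' -> (nsuccessful x k < nsuccessful x k')%N.
Proof.
move=> lt_k sk'; apply: fproper_ltn_card; rewrite fproperE.
apply/andP; split.
  rewrite -fset_set_sub; try exact: finite_successful_upto.
  move=> j [sj /= ltj]; split=> //=.
  by apply: leq_trans ltj _; rewrite ltnS ltnW.
apply/negP => /fsubsetP/(_ k').
rewrite in_fset_set ?inE; last exact: finite_successful_upto.
move=> /(_ _)/wrap[|/mem_successful_upto[_]]; first by split=> /=.
by rewrite leqNgt lt_k.
Qed.

Lemma nsuccessful_cvgny (T : Type) (x : nat -> T) :
  (forall K, exists2 k, (K <= k)%N & successful x k) ->
  nsuccessful x k @[k --> \oo] --> \oo.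
Proof.
move=> x_inf; apply/cvgnyPge => A.
suff [K leAK] : exists K, (A <= nsuccessful x K)%N.
  near=> k; apply: leq_trans leAK (leq_nsuccessful _ _).
  by near: k; exact: nbhs_infty_ge.
elim: A => [|A [K leAK]]; first by exists 0%N.
have [k ltKk sk] := x_inf K.+1.
by exists k; apply: leq_ltn_trans leAK (ltn_nsuccessful _ _).
Unshelve. all: by end_near. Qed.

Lemma ell_cvgny (T : Type) (x : nat -> T) :
  (forall K, exists2 k, (K <= k)%N & successful x k) ->
  ell x k @[k --> \oo] --> \oo.
Proof.
move=> /nsuccessful_cvgny/cvgnyPge x_cvg; apply/cvgnyPge => A.
apply: filterS (x_cvg A.+1.*2) => k le_k.
apply: leq_trans (truncn_median_ge _).
rewrite -/(nsuccessful x k); lia.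
Qed.

(** * Convergence of the optimality measure and the iteration bound *)

Lemma eq_iterate_no_success (T : Type) (x : nat -> T) (k j : nat) :
  (k <= j)%N -> (forall i, (k <= i < j)%N -> ~ successful x i) -> x j = x k.
Proof.
elim: j => [|j IH]; first by rewrite leqn0 => /eqP ->.
rewrite leq_eqVlt => /orP[/eqP -> //|]; rewrite ltnS => lekj nos.
have /contrapT -> := nos j ltac:(by rewrite lekj /=).
by apply: IH => // i /andP[leki ltij]; apply: nos; rewrite leki ltnW.
Qed.

(** The iterate does not move until the first success after k, so that success
    takes place at the point [x k]. *)
Lemma next_success (T : Type) (x : nat -> T) (k : nat) :
  (exists2 j, (k <= j)%N & successful x j) ->
  exists2 j, (k <= j)%N & successful x j /\ x j = x k.
Proof.
case=> j0 lekj0 sj0.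
have h : exists j, (k <= j)%N && `[< successful x j >].
  by exists j0; rewrite lekj0; exact/asboolP.
case: (ex_minnP h) => j /andP[lekj /asboolP sj] j_min; exists j => //; split=> //.
apply: eq_iterate_no_success => // i /andP[leki ltij] si.
by have := j_min i; rewrite leki leqNgt ltij asboolT// => /(_ isT).
Qed.

(** After K the iterates, hence omega and the number of successes, are constant.
    If omega were positive there, the right-hand side of the iteration bound
    would be a fixed number exceeding every index. *)
Lemma omega_eq0_no_success (R : realType) (T : Type) (x : nat -> T)
    (omega : T -> R) (kappa_a kappa_b kappa_c : R) (K : nat) :
  (forall z, 0 <= omega z) -> 0 <= kappa_a ->
  (forall k, 0 < omega (x k) ->
     k%:R <= kappa_a * (nsuccessful x k)%:R
             + kappa_b * `|ln (omega (x k))| + kappa_c) ->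
  (forall k, (K <= k)%N -> ~ successful x k) -> omega (x K) = 0.
Proof.
move=> omega_ge0 kappa_a_ge0 iter_bound nos.
apply/eqP; rewrite eq_le omega_ge0 andbT leNgt; apply/negP => omega_gt0.
pose B := kappa_a * (nsuccessful x K)%:R
          + kappa_b * `|ln (omega (x K))| + kappa_c.
(* An index past K that exceeds the constant bound B. *)
pose k := maxn K (Num.truncn B).+1.
have leKk : (K <= k)%N by exact: leq_maxl.
have xk : x k = x K.
  by apply: eq_iterate_no_success => // i /andP[+ _]; exact: nos.
have := iter_bound k; rewrite xk => /(_ omega_gt0); apply/negP; rewrite -ltNge.
apply: (@le_lt_trans _ _ B).
  rewrite !lerD2r ler_wpM2l// ler_nat; apply: fsubset_leq_card.
  rewrite -fset_set_sub; try exact: finite_successful_upto.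
  move=> j [sj _]; split=> //=; rewrite ltnS leqNgt; apply/negP => ltKj.
  by apply: (nos j) => //; exact: ltnW.
apply: lt_le_trans (truncnS_gt _) _.
by rewrite ler_nat leq_maxr.
Qed.

(** Successive differences of f vanish because f converges along the iterates, and
    they control omega at the successes; any other index is reduced to the next
    success, unless no success follows and omega is 0 there. *)
Lemma omega_cvg0 (R : realType) (T : Type) (f omega : T -> R) (x : nat -> T)
    (kappa_d beta : R) :
  (forall k, f (x k.+1) <= f (x k)) ->
  has_lbound (range (fun k => f (x k))) ->
  (forall z, 0 <= omega z) -> 0 < kappa_d -> 0 < beta ->
  (forall k, successful x k ->
     kappa_d * omega (x k) `^ beta <= f (x k) - f (x k.+1)) ->
  (forall K, (forall k, (K <= k)%N -> ~ successful x k) -> omega (x K) = 0) ->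
  omega (x k) @[k --> \oo] --> 0.
Proof.
move=> f_decr f_lb omega_ge0 kappa_d0 beta0 decrease tail0.
have f_mono : {homo (fun k => f (x k)) : i j / (i <= j)%N >-> j <= i}.
  exact/nonincreasing_seqP.
have f_cvg := nonincreasing_is_cvgn f_mono f_lb.
have df_cvg : f (x k) - f (x k.+1) @[k --> \oo] --> 0.
  rewrite -(subrr (limn (fun k => f (x k)))).
  apply: cvgB; first exact: f_cvg.
  by rewrite (cvg_shiftS (fun k => f (x k))).
apply/cvgrPdist_le => e e0.
have c0 : 0 < kappa_d * e `^ beta by rewrite mulr_gt0 ?powR_gt0.
have [K _ df_lt] := @cvgr_lt _ _ _ _ _ _ df_cvg _ c0.
exists K => // k /= leKk; rewrite sub0r normrN ger0_norm//.
have [/next_success[j lekj [sj <-]]|nos] :=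
    pselect (exists2 j, (k <= j)%N & successful x j).
  rewrite leNgt; apply/negP => lt_e.
  have := df_lt j (leq_trans leKk lekj); apply/negP; rewrite -leNgt.
  apply: le_trans (decrease _ sj).
  rewrite ler_wpM2l ?(ltW kappa_d0)// ge0_ler_powR ?nnegrE ?(ltW e0) ?(ltW beta0)//.
  exact: ltW.
rewrite tail0 ?ltW// => j lekj sj.
by apply: nos; exists j.
Qed.

(** The iteration bound is applied at k - 1, the last index where omega is known to
    exceed eps: there [omega <= 1] allows replacing [`|ln omega|] by the larger
    [`|ln eps|], and the unit lost between k - 1 and k is paid by the extra
    [kappa_a >= 1]. *)
Lemma first_below_bound (R : realType) (T : Type) (f omega : T -> R)
    (x : nat -> T) (kappa_a kappa_b kappa_c kappa_d beta eps : R) :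
  let k := first_below (fun k => omega (x k)) eps in
  (forall k, f (x k.+1) <= f (x k)) ->
  0 < kappa_d -> 0 < beta ->
  (forall k, successful x k ->
     kappa_d * omega (x k) `^ beta <= f (x k) - f (x k.+1)) ->
  1 <= kappa_a -> 0 <= kappa_b ->
  (forall k, 0 < omega (x k) ->
     k%:R <= kappa_a * (nsuccessful x k)%:R
             + kappa_b * `|ln (omega (x k))| + kappa_c) ->
  (exists k, omega (x k) <= eps) ->
  0 < eps -> (0 < k)%N -> omega (x k.-1) <= 1 ->
  k%:R <= kappa_a * (2 * (f (x (ell x k.-1)) - f (x k)) / (kappa_d * eps `^ beta))
          + kappa_b * `|ln eps| + kappa_a + kappa_c.
Proof.
move=> k f_decr kappa_d0 beta0 decrease kappa_a1 kappa_b0 iter_bound below.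
move=> eps0 k_gt0 omega_le1.
have [_ gt_eps] := first_belowP below.
have ltk : (k.-1 < k)%N by rewrite prednK.
have c0 : 0 < kappa_d * eps `^ beta by rewrite mulr_gt0 ?powR_gt0.
have := @nsuccessful_le_ell _ x _ (fun j => f (x j)) _ k.-1 f_decr (ltW c0).
move=> /(_ _)/wrap[j sj lejk|].
  apply: le_trans (decrease _ sj).
  rewrite ler_wpM2l ?(ltW kappa_d0)//.
  rewrite ge0_ler_powR ?nnegrE ?(ltW beta0) ?(ltW eps0)//.
    by apply: le_trans (ltW (gt_eps j _)); [exact: ltW|exact: leq_ltn_trans ltk].
  by apply/ltW/gt_eps; exact: leq_ltn_trans ltk.
rewrite prednK// -ler_pdivlMr// => le_s.
have := iter_bound k.-1 (lt_trans eps0 (gt_eps _ ltk)).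
have := norm_ln_le eps0 (ltW (gt_eps _ ltk)) omega_le1.
move=> /(ler_wpM2l kappa_b0) le_ln.
have := ler_wpM2l (le_trans ler01 kappa_a1) le_s.
have -> : k%:R = k.-1%:R + 1 :> R by rewrite natr1 prednK.
lra.
Qed.

Theorem theorem2p1 (R : realType) (n : nat)
    (f : 'rV[R]_n -> R) (x : nat -> 'rV[R]_n) (omega : 'rV[R]_n -> R)
    (kappa_a kappa_b kappa_c kappa_d beta : R)
    (f_decr : forall k, f (x k.+1) <= f (x k))
    (f_lb : has_lbound (range (fun k => f (x k))))
    (omega_ge0 : forall z, 0 <= omega z)
    (omega_neq0 : successful x `&` [set k | omega (x k) = 0] = set0)
    (kappa_d_gt0 : 0 < kappa_d) (kappa_d_le1 : kappa_d <= 1)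
    (beta_gt0 : 0 < beta)
    (decrease : forall k, successful x k ->
       kappa_d * omega (x k) `^ beta <= f (x k) - f (x k.+1))
    (kappa_a_ge1 : 1 <= kappa_a)
    (kappa_b_ge0 : 0 <= kappa_b) (kappa_c_ge0 : 0 <= kappa_c)
    (iter_bound : forall k, 0 < omega (x k) ->
       k%:R <= kappa_a * (nsuccessful x k)%:R
               + kappa_b * `|ln (omega (x k))| + kappa_c) :
  let k_ := first_below (fun k => omega (x k)) in
  [/\ omega (x k) @[k --> \oo] --> 0,
      (exists N : nat, \forall eps \near (0 : R)^'+, k_ eps = N)
      \/
      ((\forall eps \near (0 : R)^'+,
          (* k_ eps - 1 and ell (k_ eps - 1) are well defined *)
          [/\ (0 < k_ eps)%N,
              successful_upto x (k_ eps).-1 !=set0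
            & (k_ eps)%:R <=
              kappa_a * Num.max 1
                (2 * (f (x (ell x (k_ eps).-1)) - f (x (k_ eps)))
                 / (kappa_d * eps `^ beta))
              + kappa_b * `|ln eps| + kappa_a + kappa_c])
       /\ (f (x (ell x (k_ eps).-1)) - f (x (k_ eps).-1)) @[eps --> (0 : R)^'+]
            --> 0)
    & is_little_o (fun eps => (k_ eps)%:R) (fun eps => eps `^ (- beta))].
Proof.
move=> k_.
have f_mono : {homo (fun k => f (x k)) : i j / (i <= j)%N >-> j <= i}.
  exact/nonincreasing_seqP.
have f_cvg := nonincreasing_is_cvgn f_mono f_lb.
have tail0 K : (forall k, (K <= k)%N -> ~ successful x k) -> omega (x K) = 0.
  apply: (omega_eq0_no_success omega_ge0 _ iter_bound).
  exact: le_trans kappa_a_ge1.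
have omega_cvg : omega (x k) @[k --> \oo] --> 0.
  exact: (omega_cvg0 f_decr f_lb omega_ge0 kappa_d_gt0 beta_gt0 decrease tail0).
have powR_cvg := powR_cvg0 beta_gt0.
have [/(first_below_cst (fun k => omega_ge0 (x k)))[N k_N]|omega_n0] :=
    pselect (exists k, omega (x k) = 0).
  split=> //; first by left; exists N.
  apply: (@is_little_o_le _ _ _ (fun eps => N%:R * eps `^ beta)).
    near=> eps; rewrite powRN invrK.
    by have -> : k_ eps = N by near: eps.
  by rewrite -[X in _ --> X](mulr0 N%:R); apply: cvgM powR_cvg; exact: cvg_cst.
have omega_gt0 k : 0 < omega (x k).
  by rewrite lt0r omega_ge0 andbT; apply/eqP => wk0; apply: omega_n0; exists k.
have below eps : 0 < eps -> exists k, omega (x k) <= eps.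
  move=> eps0; have [K _ wK] := @cvgr_le _ _ _ _ _ _ omega_cvg eps eps0.
  by exists K; apply: (wK K) => /=.
have x_inf K : exists2 k, (K <= k)%N & successful x k.
  apply: contrapT => nos; apply: omega_n0; exists K; apply: tail0 => k leKk sk.
  by apply: nos; exists k.
have k_cvg : k_ eps @[eps --> (0 : R)^'+] --> \oo.
  exact: first_below_cvgny omega_gt0 omega_cvg.
have k1_cvg : (k_ eps).-1 @[eps --> (0 : R)^'+] --> \oo.
  apply/cvgnyPge => A; move/cvgnyPge : k_cvg => /(_ A.+1).
  by apply: filterS => eps; lia.
have ell_cvg : ell x (k_ eps).-1 @[eps --> (0 : R)^'+] --> \oo.
  exact: cvg_comp k1_cvg (ell_cvgny x_inf).
have f_comp (h : R -> nat) : h eps @[eps --> (0 : R)^'+] --> \oo ->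
    f (x (h eps)) @[eps --> (0 : R)^'+] --> limn (fun k => f (x k)).
  by move=> h_cvg; exact: (cvg_comp _ _ h_cvg f_cvg).
have diff_cvg (g h : R -> nat) : g eps @[eps --> (0 : R)^'+] --> \oo ->
    h eps @[eps --> (0 : R)^'+] --> \oo ->
    (f (x (g eps)) - f (x (h eps))) @[eps --> (0 : R)^'+] --> 0.
  move=> g_cvg h_cvg; rewrite -[X in _ --> X](subrr (limn (fun k => f (x k)))).
  by apply: cvgB; [exact: (f_comp _ g_cvg) | exact: (f_comp _ h_cvg)].
have k_gt0 : \forall eps \near (0 : R)^'+, (0 < k_ eps)%N.
  by move/cvgnyPge : k_cvg => /(_ 1%N).
have k_bound : \forall eps \near (0 : R)^'+, (k_ eps)%:R <=
    kappa_a * (2 * (f (x (ell x (k_ eps).-1)) - f (x (k_ eps)))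
               / (kappa_d * eps `^ beta))
    + kappa_b * `|ln eps| + kappa_a + kappa_c.
  near=> eps; have eps0 : 0 < eps by [].
  apply: first_below_bound => //; first exact: below.
    by near: eps; exact: k_gt0.
  rewrite -/(k_ eps); near: eps.
  exact: (k1_cvg _ (@cvgr_le _ _ _ _ _ _ omega_cvg 1 ltr01)).
split=> //.
  right; split; last exact: diff_cvg.
  have [j _ sj] := x_inf 0%N.
  near=> eps; split.
  - by near: eps; exact: k_gt0.
  - exists j; split=> //=; rewrite ltnS.
    by near: eps; move/cvgnyPge : k1_cvg => /(_ j).
  - apply: (le_trans (near k_bound eps _)) => //.
    rewrite !lerD2r ler_wpM2l ?(le_trans _ kappa_a_ge1)//.
    by rewrite le_max lexx orbT.
(* The bound on k(eps), multiplied by [eps `^ beta]. *)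
apply: (@is_little_o_le _ _ _ (fun eps =>
    kappa_a * (2 / kappa_d)
      * (f (x (ell x (k_ eps).-1)) - f (x (k_ eps)))
    + kappa_b * (eps `^ beta * `|ln eps|) + (kappa_a + kappa_c) * eps `^ beta)).
  near=> eps; have eps0 : 0 < eps by [].
  have p0 : 0 < eps `^ beta by rewrite powR_gt0.
  rewrite powRN invrK -ler_pdivlMr//.
  apply: (le_trans (near k_bound eps _)) => //.
  rewrite le_eqVlt; apply/orP; left; apply/eqP; field.
  by rewrite !gt_eqF.
rewrite [X in _ --> X](_ : _ = kappa_a * (2 / kappa_d) * 0 + kappa_b * 0
                               + (kappa_a + kappa_c) * 0); last first.
  by rewrite !mulr0 !addr0.
apply: cvgD; first apply: cvgD.
- by apply: cvgM; [exact: cvg_cst | exact: diff_cvg].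
- by apply: cvgM; [exact: cvg_cst | exact: powR_norm_ln_cvg0].
- by apply: cvgM; [exact: cvg_cst | exact: powR_cvg].
Unshelve. all: by end_near. Qed.
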